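(* Let $F$ be a finite field with $|F|=q$, let $n>1$ be an odd integer with $\gcd(n,q)=1$, and let $G$ be an abelian group of order $n$. The following four are equivalent: (1) Self-dual $2$-quasi-$FG$ codes exist. (2) Self-dual $2$-quasi-$FG$ codes of type I exist. (3) $-1$ is a square element of $F$. (4) Either $q$ is even, or $4\mid q-1$.
   Context: $FG$ is the group algebra. A $2$-quasi-$FG$ code is an $FG$-submodule $C$ of $(FG)^2=FG\times FG$; it is of type I if $C=\{(u,ub)\mid u\in FG\}$ for some $b\in FG$. The inner product on $(FG)^2$ is the Euclidean one, $\langle(a,b),(a',b')\rangle=\sum_{x\in G}(a_xa'_x+b_xb'_x)$ for $a=\sum a_xx$, etc. $C$ is self-dual if $C=C^\perp$. *)

(* Defs.v *)
From HB Require Import structures.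
From mathcomp Require Import all_boot all_order all_algebra all_fingroup.

Set Implicit Arguments.
Unset Strict Implicit.
Unset Printing Implicit Defensive.

Import GRing.Theory.
Local Open Scope ring_scope.

(* The element \sum_x a_x x is encoded by its coefficient function x |-> a_x.
   This is an alias of {ffun G -> F}, whose own multiplication in the library
   is pointwise; on groupAlg F G the product is the convolution below. *)
Definition groupAlg (F : Type) (G : finGroupType) : Type := {ffun G -> F}.

HB.instance Definition _ (F : eqType) (G : finGroupType) :=
  Equality.copy (groupAlg F G) {ffun G -> F}.
HB.instance Definition _ (F : choiceType) (G : finGroupType) :=
  Choice.copy (groupAlg F G) {ffun G -> F}.
HB.instance Definition _ (F : finType) (G : finGroupType) :=
  Finite.copy (groupAlg F G) {ffun G -> F}.
HB.instance Definition _ (F : zmodType) (G : finGroupType) :=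
  GRing.Zmodule.copy (groupAlg F G) {ffun G -> F}.

Definition gcoef (F : Type) (G : finGroupType) (a : groupAlg F G) (x : G) : F :=
  (a : {ffun G -> F}) x.

Section GroupAlgebra.
Variables (F : nzRingType) (G : finGroupType).
Implicit Types (a b c : groupAlg F G).

Definition galg_one : groupAlg F G := [ffun x => (x == 1%g)%:R].

Definition galg_mul a b : groupAlg F G :=
  [ffun x => \sum_(y : G) gcoef a y * gcoef b (y^-1 * x)%g].

Lemma galg_ext a b : (forall x, gcoef a x = gcoef b x) -> a = b.
Proof. by move=> ab; apply/ffunP. Qed.

Lemma gcoefD a b x : gcoef (a + b) x = gcoef a x + gcoef b x.
Proof. by rewrite /gcoef ffunE. Qed.

Lemma gcoef_mul a b x :
  gcoef (galg_mul a b) x = \sum_(y : G) gcoef a y * gcoef b (y^-1 * x)%g.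
Proof. by rewrite /gcoef ffunE. Qed.

Lemma gcoef_one x : gcoef galg_one x = (x == 1%g)%:R.
Proof. by rewrite /gcoef ffunE. Qed.

Fact galg_mulA : associative galg_mul.
Proof.
move=> a b c; apply: galg_ext => x; rewrite !gcoef_mul.
under eq_bigr => y _ do rewrite gcoef_mul mulr_sumr.
under [RHS]eq_bigr => z _ do rewrite gcoef_mul mulr_suml.
rewrite [RHS]exchange_big; apply: eq_bigr => y _ /=.
rewrite [RHS](reindex_inj (mulgI y)); apply: eq_bigr => z _ /=.
by rewrite mulKg mulrA invMg mulgA.
Qed.

Fact galg_mul1l : left_id galg_one galg_mul.
Proof.
move=> a; apply: galg_ext => x; rewrite gcoef_mul (bigD1 1%g) //= big1.
  by rewrite gcoef_one eqxx mul1r invg1 mul1g addr0.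
by move=> y /negPf ne; rewrite gcoef_one ne mul0r.
Qed.

Fact galg_mul1r : right_id galg_one galg_mul.
Proof.
move=> a; apply: galg_ext => x; rewrite gcoef_mul (bigD1 x) //= big1.
  by rewrite gcoef_one mulVg eqxx mulr1 addr0.
move=> y ne; rewrite gcoef_one -eq_mulVg1.
by rewrite (negPf ne) mulr0.
Qed.

Fact galg_mulDl : left_distributive galg_mul +%R.
Proof.
move=> a b c; apply: galg_ext => x; rewrite gcoefD !gcoef_mul -big_split /=.
by apply: eq_bigr => y _; rewrite gcoefD mulrDl.
Qed.

Fact galg_mulDr : right_distributive galg_mul +%R.
Proof.
move=> a b c; apply: galg_ext => x; rewrite gcoefD !gcoef_mul -big_split /=.
by apply: eq_bigr => y _; rewrite gcoefD mulrDr.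
Qed.

Fact galg_one_neq0 : galg_one != 0.
Proof.
apply/eqP => /(congr1 (fun a => gcoef a 1%g)).
by rewrite gcoef_one eqxx /gcoef ffunE => /eqP; rewrite oner_eq0.
Qed.

HB.instance Definition _ := GRing.Zmodule_isNzRing.Build (groupAlg F G)
  galg_mulA galg_mul1l galg_mul1r galg_mulDl galg_mulDr galg_one_neq0.

Lemma gcoefM a b x :
  gcoef (a * b) x = \sum_(y : G) gcoef a y * gcoef b (y^-1 * x)%g.
Proof. exact: gcoef_mul. Qed.

HB.instance Definition _ :=
  GRing.Lmodule.copy (groupAlg F G) {ffun G -> F^o}.

Lemma gcoefZ (k : F) a x : gcoef (k *: a) x = k * gcoef a x.
Proof. by rewrite /gcoef ffunE. Qed.

Fact galg_scalerAl (k : F) a b : k *: (a * b) = (k *: a) * b.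
Proof.
apply: galg_ext => x; rewrite gcoefZ !gcoefM mulr_sumr.
by apply: eq_bigr => y _; rewrite gcoefZ mulrA.
Qed.

HB.instance Definition _ :=
  GRing.Lmodule_isLalgebra.Build F (groupAlg F G) galg_scalerAl.

End GroupAlgebra.

Section GroupAlgebraCom.
Variables (F : comNzRingType) (G : finGroupType).

Fact galg_scalerAr (k : F) (a b : groupAlg F G) : k *: (a * b) = a * (k *: b).
Proof.
apply: galg_ext => x; rewrite gcoefZ !gcoefM mulr_sumr.
by apply: eq_bigr => y _; rewrite gcoefZ mulrCA.
Qed.

HB.instance Definition _ :=
  GRing.Lalgebra_isAlgebra.Build F (groupAlg F G) galg_scalerAr.

End GroupAlgebraCom.

(* As groupAlg F G acts on (groupAlg F G)^o by left multiplication, the scaling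
   of this left module over groupAlg F G is r *: (a, b) = (r * a, r * b). *)
Notation FG2 F G := ((groupAlg F G)^o * (groupAlg F G)^o)%type.

Section QuasiGroupCodes.
Variables (F : finFieldType) (G : finGroupType).

Definition inner (v w : FG2 F G) : F :=
  \sum_(x : G) (gcoef v.1 x * gcoef w.1 x + gcoef v.2 x * gcoef w.2 x).

Definition dual_code (C : {set FG2 F G}) : {set FG2 F G} :=
  [set v | [forall w in C, inner v w == 0]].

Definition quasi_code (C : {set FG2 F G}) : Prop := submod_closed C.

Definition self_dual (C : {set FG2 F G}) : Prop := C = dual_code C.

Definition typeI (C : {set FG2 F G}) : Prop :=
  exists b : groupAlg F G, C = [set ((u, u * b) : FG2 F G) | u : groupAlg F G].

End QuasiGroupCodes.

(* Main.v *)
(* If C is self-dual, N = \sum_x x and eps is the augmentation, then some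
   (a, b) in C has eps a != 0: otherwise (N, 0) would be orthogonal to C, hence
   in C, although its norm n is nonzero in F. Now (N a, N b) = (eps a N, eps b N)
   lies in C and has norm n (eps a ^ 2 + eps b ^ 2) = 0, so -1 is the square of
   eps b / eps a. Conversely, if i ^ 2 = -1 then {(u, i u)} is self-dual.
   Whether -1 is a square is decided by Euler's criterion. *)
Require Import Defs.
From HB Require Import structures.
From mathcomp Require Import all_boot all_order all_algebra all_fingroup.
From mathcomp Require Import cyclic pgroup finfield.

Import GRing.Theory.

Local Open Scope ring_scope.

Section MinusOneSquare.
Variable F : finFieldType.

(** Lagrange in the additive group of [F]. *)
Lemma natf_card_eq0 : #|F|%:R = 0 :> F.
Proof.
by rewrite -FinRing.zmodXgE -[#|F|]cardsT; apply/eqP; rewrite expg_cardG ?inE.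
Qed.

(** If [m] vanished in [F], the characteristic would divide both [m] and [#|F|]. *)
Lemma coprime_card_natf_neq0 (m : nat) : coprime m #|F| -> m%:R != 0 :> F.
Proof.
have [p p_pr pF] := finPcharP F.
apply: contraTneq => m0; rewrite /coprime.
have pm : (p %| gcdn m #|F|)%N.
  by rewrite dvdn_gcd !(dvdn_pcharf pF) m0 natf_card_eq0 eqxx.
by apply: contraTneq pm => ->; rewrite dvdn1; case: p p_pr {pF} => [|[]].
Qed.

(** The additive group is a p-group for p the characteristic, so even order forces p = 2. *)
Lemma even_card_opp1 : ~~ odd #|F| -> - 1 = 1 :> F.
Proof.
rewrite -dvdn2 => evenF.
have [p p_pr pF] := finPcharP F.
have /pgroupP/(_ 2 isT) : (p.-group [set: F])%g := pprimeChar_pgroup pF.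
rewrite cardsT => /(_ evenF); rewrite inE /= => /eqP e2.
by rewrite -e2 in pF; rewrite (oppr_pchar2 pF).
Qed.

Lemma odd_card_opp1 : odd #|F| -> - 1 != 1 :> F.
Proof.
move=> oddF; rewrite -subr_eq0 -opprD oppr_eq0 -[1 + 1]/2%:R.
by apply: coprime_card_natf_neq0; rewrite coprime2n.
Qed.

Lemma expf_card_pred (x : F) : x != 0 -> x ^+ #|F|.-1 = 1.
Proof.
move=> x0; apply: (mulfI x0); rewrite -exprS.
by rewrite (ltn_predK (finNzRing_gt1 F)) expf_card mulr1.
Qed.

Lemma sqr_opp1_card (a : F) :
  a ^+ 2 = - 1 -> ~~ odd #|F| \/ (4 %| #|F| - 1)%N.
Proof.
move=> a2; case: (boolP (odd #|F|)) => oddF; [right | by left].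
have a0 : a != 0.
  by apply: contra_eq_neq a2 => ->; rewrite expr0n eq_sym oppr_eq0 oner_neq0.
have := expf_card_pred _ a0; rewrite subn1.
have oddE : ~~ odd #|F|.-1 by rewrite -subn1 oddB ?oddF // (ltnW (finNzRing_gt1 F)).
(* With q = [#|F|], 1 = a^(q-1) = (-1)^((q-1)/2); an odd exponent (q-1)/2 would give -1 = 1. *)
rewrite -[#|F|.-1]odd_double_half (negPf oddE) add0n -muln2 (mulnC _ 2).
rewrite exprM a2 -signr_odd; case: odd (dvdn2 (#|F|.-1)./2) => /= [_|d2 _].
  by move/eqP; rewrite expr1 (negPf (odd_card_opp1 oddF)).
by rewrite -[4%N]/(2 * 2)%N dvdn_pmul2l.
Qed.

Lemma card_sqr_opp1 :
  ~~ odd #|F| \/ (4 %| #|F| - 1)%N -> exists a : F, a ^+ 2 = - 1.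
Proof.
case=> [evenF|/dvdnP[k kF]].
  by exists 1; rewrite expr1n even_card_opp1.
have F1 := finNzRing_gt1 F; rewrite subn1 in kF.
have k0 : (0 < k)%N.
  by case: k kF => // /eqP; rewrite mul0n -subn1 subn_eq0 leqNgt F1.
(* X^(2k) - 1 has fewer than 4k = q - 1 roots; on a nonroot u != 0 the square
   of u^(2k) is 1, so u^(2k) = -1. *)
suff [u u0 uk] : exists2 u : F, u != 0 & u ^+ (2 * k) != 1.
  exists (u ^+ k); apply/eqP; rewrite -exprM mulnC.
  have /eqP := expf_card_pred _ u0; rewrite kF -[4%N]/(2 * 2)%N mulnC -mulnA.
  by rewrite mulnC exprM sqrf_eq1 (negPf uk).
apply/exists_inP; rewrite -[X in is_true X]negbK negb_exists_in.
apply/negP => /forall_inP roots.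
have p0 : 'X^(2 * k) - 1 != 0 :> {poly F}.
  by rewrite -size_poly_eq0 size_Xn_sub_1 ?muln_gt0.
have := max_poly_roots (rs := enum (predC1 (0 : F))) p0.
rewrite enum_uniq -cardE cardC1 size_Xn_sub_1 ?muln_gt0 // kF => H.
suff : (k * 4 < (2 * k).+1)%N.
  by rewrite ltnS mulnC leq_pmul2r.
apply: H => //; apply/allP => u; rewrite mem_enum => /roots.
by rewrite negbK rootE !hornerE subr_eq0.
Qed.

End MinusOneSquare.

Section Codes.
Variables (F : finFieldType) (G : finGroupType).
Implicit Types (a b u : groupAlg F G) (C : {set FG2 F G}).

Definition augm a : F := \sum_x gcoef a x.

(** This is k N, where N is the sum of all group elements. *)
Definition galg_const (k : F) : groupAlg F G := [ffun=> k].

Lemma gcoef_const k x : gcoef (galg_const k) x = k.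
Proof. by rewrite /gcoef ffunE. Qed.

Lemma galg_const1_mul a : galg_const 1 * a = galg_const (augm a).
Proof.
apply: galg_ext => x; rewrite gcoefM gcoef_const /augm.
rewrite (reindex_inj (inj_comp (mulgI x) invg_inj)) /=.
by apply: eq_bigr => y _; rewrite gcoef_const mul1r invMg invgK mulgKV.
Qed.

Lemma self_dual_sqr_opp1 C :
  #|G|%:R != 0 :> F -> quasi_code C -> self_dual C ->
  exists a : F, a ^+ 2 = - 1.
Proof.
move=> nG [C0 Clin] dualC.
have orth v w : v \in C -> w \in C -> inner v w = 0.
  by rewrite {1}dualC inE => /forall_inP vC /vC/eqP.
have inner_const k l w :
    inner (galg_const k, galg_const l) w = k * augm w.1 + l * augm w.2.
  rewrite /inner /augm !mulr_sumr -big_split.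
  by apply: eq_bigr => x _; rewrite !gcoef_const.
have augm_const k : augm (galg_const k) = #|G|%:R * k.
  rewrite /augm (eq_bigr (fun=> k)) => [|x _]; last exact: gcoef_const.
  by rewrite sumr_const mulr_natl.
have [w wC w1] : exists2 w, w \in C & augm w.1 != 0.
  apply/exists_inP; apply: contraT; rewrite negb_exists_in => /forall_inP aug0.
  have N1C : (galg_const 1, galg_const 0) \in C.
    rewrite dualC inE; apply/forall_inP => w /aug0; rewrite negbK => /eqP w0.
    by rewrite inner_const w0 mulr0 mul0r addr0.
  move: (aug0 _ N1C); rewrite negbK /= augm_const mulr1.
  by rewrite (negPf nG).
have NwC : (galg_const (augm w.1), galg_const (augm w.2)) \in C.
  have := Clin (galg_const 1) w 0 wC C0; rewrite addr0.
  by rewrite -!galg_const1_mul.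
(* Pairing N w with w, rather than with itself, gives eps(a)^2 + eps(b)^2 = 0 without the factor
   n. *)
have := orth _ _ NwC wC; rewrite inner_const => /eqP; rewrite addr_eq0 => /eqP e.
exists (augm w.2 / augm w.1).
by rewrite expr_div_n -[_ ^+ 2]opprK [_ w.2 ^+ 2]expr2 -e -expr2 mulNr divff ?expf_neq0.
Qed.

Lemma scaled_diagonal_self_dual (i : F) : i ^+ 2 = - 1 ->
  exists C, [/\ quasi_code C, self_dual C & typeI C].
Proof.
move=> i2; pose C := [set ((u, u * i%:A) : FG2 F G) | u : groupAlg F G].
have mulA u : u * i%:A = i *: u by rewrite -scalerAr mulr1.
exists C; split; last by exists i%:A.
- split; first by apply/imsetP; exists 0; rewrite ?mul0r.
  move=> r _ _ /imsetP[u _ ->] /imsetP[v _ ->].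
  apply/imsetP; exists (r * u + v) => //.
  by rewrite mulrDl -mulrA.
apply/setP => -[a b]; rewrite inE; apply/imsetP/forall_inP.
  (* Self-orthogonality holds coefficientwise: u_x v_x + i^2 u_x v_x = 0. *)
  case=> u _ [-> ->] _ /imsetP[v _ ->].
  rewrite /inner big1 //= => x _.
  by rewrite !mulA !gcoefZ mulrACA -expr2 i2 mulN1r subrr.
move=> orth; exists a => //; congr pair; rewrite mulA; apply: galg_ext => x.
(* Testing against the codeword of the group element x isolates a_x + i b_x = 0, which is b_x = i
   a_x. *)
pose d : groupAlg F G := [ffun y => (y == x)%:R].
have dE y : gcoef d y = (y == x)%:R by rewrite /gcoef ffunE.
have /eqP := orth (d, d * i%:A) (imset_f _ isT).
rewrite /inner (bigD1 x) //= big1 ?addr0 => [|y /negPf yx].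
  rewrite mulA !gcoefZ dE eqxx !mulr1 => /eqP; rewrite addr_eq0 => /eqP ->.
  by rewrite mulrN mulrCA -expr2 i2 mulrN1 opprK.
by rewrite mulA gcoefZ dE yx !mulr0 addr0.
Qed.

End Codes.

Theorem corollary4p5 (F : finFieldType) (q : nat) (hq : #|F| = q)
    (n : nat) (hn1 : (1 < n)%N) (hodd : odd n) (hgcd : gcdn n q = 1%N)
    (G : finGroupType) (hab : abelian [set: G]) (hG : #|G| = n) :
  [<-> exists C : {set FG2 F G}, quasi_code C /\ self_dual C;
       exists C : {set FG2 F G}, [/\ quasi_code C, self_dual C & typeI C];
       exists a : F, a ^+ 2 = - 1;
       ~~ odd q \/ (4 %| q - 1)%N].
Proof.
have nG : #|G|%:R != 0 :> F.
  by apply: coprime_card_natf_neq0; rewrite /coprime hG hq hgcd.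
have code_sqr (C : {set FG2 F G}) : quasi_code C -> self_dual C -> exists a : F, a ^+ 2 = - 1.
  exact: self_dual_sqr_opp1.
tfae.
(* The type I code is not derived from [C] itself: [C] only supplies a square root of -1, from which
   a new code is built. *)
- by case=> C [qC /(code_sqr C qC)[i /scaled_diagonal_self_dual]].
- by case=> C [qC sC _]; apply: code_sqr sC.
- by case=> a; rewrite -hq; apply: sqr_opp1_card.
- rewrite -hq => /card_sqr_opp1[i /(scaled_diagonal_self_dual F G)[C [qC sC _]]].
  by exists C.
Qed.
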